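(* Let $1<p<\infty$ and let $\omega:\mathbb{R}_+\to\mathbb{R}_+$ be continuous with $\omega\in B_p(0)$. Then $$D^{1,p}_0(\mathbb{R}_+,\omega)=\mathcal{R}^0_{p,\omega}(0)\iff\omega\notin B_p(\infty).$$
   Context: $\mathbb{R}_+=(0,\infty)$. $\omega\in B_p(0)$ means $\int_0^1\omega^{-1/(p-1)}\,d\tau<\infty$; $\omega\in B_p(\infty)$ means $\int_1^\infty\omega^{-1/(p-1)}\,d\tau<\infty$. $L^p(\mathbb{R}_+,\omega)$ is the space of measurable $f$ with $\|f\|_{L^p(\mathbb{R}_+,\omega)}=\big(\int_0^\infty|f|^p\omega\,dt\big)^{1/p}<\infty$. The weighted Dirichlet space $D^{1,p}(\mathbb{R}_+,\omega)$ consists of all locally absolutely continuous $u:\mathbb{R}_+\to\mathbb{R}$ with $\|u'\|_{L^p(\mathbb{R}_+,\omega)}<\infty$. $D^{1,p}_0(\mathbb{R}_+,\omega)$ is the set of all $u\in D^{1,p}(\mathbb{R}_+,\omega)$ for which there is a sequence $\{\phi_n\}\subseteq C_0^\infty(\mathbb{R}_+)$ (smooth functions with compact support in $(0,\infty)$) such that $\phi_n'\to u'$ in $L^p(\mathbb{R}_+,\omega)$ and $\phi_n\to u$ uniformly on compact subsets of $\mathbb{R}_+$. Finally $\mathcal{R}^0_{p,\omega}(0)=\{u\in D^{1,p}(\mathbb{R}_+,\omega):\ u(t)=\int_0^t u'(\tau)\,d\tau\ \text{ for all }t>0\}$. *)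

(* Defs.v *)
From HB Require Import structures.
From mathcomp Require Import all_boot all_order all_algebra.
From mathcomp Require Import all_classical all_reals all_analysis.
Set Implicit Arguments.
Unset Strict Implicit.
Unset Printing Implicit Defensive.
Import Order.TTheory GRing.Theory Num.Theory.
Import numFieldNormedType.Exports.
Local Open Scope ring_scope.
Local Open Scope classical_set_scope.

(* A function on the open half-line R_+ = (0, +oo) is represented by a total
   function R -> R.  Every predicate below on a weight w or on an element u of
   a function space looks only at the values on (0, +oo), so an equality of two
   such sets of total functions is the equality of the corresponding sets of
   functions on (0, +oo). *)
Definition Rpos {R : realType} : set R := `]0, +oo[%classic.

Definition Bp0 {R : realType} (p : R) (w : R -> R) : Prop :=
  (\int[lebesgue_measure]_(t in `]0%R, 1%R]) (w t `^ (- (p - 1)^-1))%:E < +oo)%E.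

Definition Bpinfty {R : realType} (p : R) (w : R -> R) : Prop :=
  (\int[lebesgue_measure]_(t in `[1%R, +oo[) (w t `^ (- (p - 1)^-1))%:E < +oo)%E.

Definition wLp_norm {R : realType} (p : R) (w f : R -> R) : \bar R :=
  ((\int[lebesgue_measure]_(t in Rpos) (`|f t| `^ p * w t)%:E) `^ p^-1)%E.

Definition wLp {R : realType} (p : R) (w : R -> R) : set (R -> R) :=
  [set f | measurable_fun Rpos f /\ (wLp_norm p w f < +oo)%E].

(* Empty (degenerate) intervals are allowed; they contribute 0 to both sums. *)
Definition abs_continuous {R : realType} (a b : R) (u : R -> R) : Prop :=
  forall e : R, 0 < e -> exists2 d : R, 0 < d &
    forall (n : nat) (x y : 'I_n -> R),
      (forall i, [/\ a <= x i, x i <= y i & y i <= b]) ->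
      trivIset [set: 'I_n] (fun i => `]x i, y i[%classic) ->
      \sum_(i < n) (y i - x i) < d ->
      \sum_(i < n) `|u (y i) - u (x i)| < e.

Definition loc_abs_continuous {R : realType} (u : R -> R) : Prop :=
  forall a b : R, 0 < a -> a <= b -> abs_continuous a b u.

(* u' is the pointwise derivative, which exists almost everywhere on (0, +oo)
   for a locally absolutely continuous u; the library's u^`() is 0 at the
   remaining points, a null set. *)
Definition dirichlet {R : realType} (p : R) (w : R -> R) : set (R -> R) :=
  [set u | loc_abs_continuous u /\ wLp p w u^`()].

(* The elements of C_0^oo(R_+), extended by 0 to R. *)
Definition test_function {R : realType} : set (R -> R) :=
  [set phi | [/\ forall (n : nat) (x : R), derivable (phi^`(n)) x 1,
                 compact (closure [set x | phi x != 0]) &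
                 closure [set x | phi x != 0] `<=` Rpos]].

Definition dirichlet0 {R : realType} (p : R) (w : R -> R) : set (R -> R) :=
  [set u | dirichlet p w u /\
    exists phi : nat -> R -> R,
      [/\ forall n, test_function (phi n),
          wLp_norm p w (fun t => ((phi n)^`())%classic t - (u^`())%classic t)
            @[n --> \oo] --> 0%E &
          forall K : set R, compact K -> K `<=` Rpos ->
            {uniform K, phi @ \oo --> u}]].

(* The integral is extended-real valued and is infinite whenever the positive or
   the negative part of u' has infinite integral, so the equation includes the
   integrability of u' on (0, t]. *)
Definition R0_0 {R : realType} (p : R) (w : R -> R) : set (R -> R) :=
  [set u | dirichlet p w u /\
    forall t : R, 0 < t ->
      ((u t)%:E = \int[lebesgue_measure]_(tau in `]0%R, t]) ((u^`())%classic tau)%:E)%E].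

(* Main.v *)
Require Import Defs.
From HB Require Import structures.
From mathcomp Require Import all_boot all_order all_algebra.
From mathcomp Require Import all_classical all_reals all_analysis.
From mathcomp Require Import measurable_realfun.
From mathcomp Require Import ring lra.
Set Implicit Arguments.
Unset Strict Implicit.
Unset Printing Implicit Defensive.
Import Order.TTheory GRing.Theory Num.Theory.
Import numFieldNormedType.Exports.
Local Open Scope ring_scope.
Local Open Scope classical_set_scope.

(** Write E_A(f) for the integral of |f|^p w over A and v = w^(-1/(p-1)) for
    the dual weight.  Everything rests on comparing E with the L^1 norm: for
    every s > 0,

      |f| <= s v + s^(1-p) |f|^p w   pointwise,

    since either |f| <= s v, or |f|^(p-1) w > s^(p-1).  Hence, wherever v is
    integrable, smallness of E(f) forces smallness of the L^1 norm of f
    ([energy_L1_small]).  The hypothesis at 0 makes v integrable on every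
    (0, t], so if phi_n are test functions with E(phi_n' - u') -> 0, then
    phi_n(t), which is the integral of phi_n' over (0, t], tends to the integral
    of u' over (0, t], uniformly for t in bounded sets ([test_function_close]).

    This gives at once that D_0^{1,p} is contained in R^0_p(0)
    ([dirichlet0_sub_R0]).  It also reduces the converse inclusion to a density
    statement: u in R^0_p(0) belongs to D_0^{1,p} as soon as u' is a limit, for
    E, of derivatives of test functions, that is, of smooth functions with
    compact support in (0, oo) and integral zero.

    Smooth compactly supported functions are E-dense ([energy_approx]); only the
    vanishing integral is an obstacle.  When v is not integrable at infinity it
    can be enforced at arbitrarily small cost: with I the integral of v
    over (1, N), the function v / I on (1, N) has integral 1 and energy I^(1-p),
    which tends to 0 as N grows, and a smooth approximation of it can absorb the
    integral of any given function ([unit_mass_small_energy],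
    [test_derivatives_dense]).

    When v is integrable at infinity, it is integrable on the whole of (0, oo),
    and the comparison holds uniformly up to t = +oo.  Test functions vanish for
    large t, so u(t) -> 0 as t -> +oo for every u in D_0^{1,p}.  The primitive of
    a nonnegative bump belongs to R^0_p(0) and has a positive limit at
    infinity, so the two spaces differ ([R0_not_sub_dirichlet0]). *)

(** * Smooth functions and smooth cutoffs *)
Section Smooth.
Context {R : realType}.
Implicit Types (f g : R -> R) (x c : R) (n k : nat).

(** Recursion on the derivative, rather than on the iterated derivatives, makes
    closure under products, compositions with affine maps and the exponential
    provable by induction on the order. *)
Fixpoint diff_times n f : Prop :=
  if n is m.+1 then (forall x, derivable f x 1) /\ diff_times m f^`()
  else True.

Definition smooth f := forall n, diff_times n f.

Lemma derive1_val f x d : is_derive x 1 f d -> f^`() x = d.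
Proof. by move=> h; rewrite derive1E derive_val. Qed.

Lemma smooth_derivable f x : smooth f -> derivable f x 1.
Proof. by move=> /(_ 1%N) []. Qed.

Lemma smooth_derive f : smooth f -> smooth f^`().
Proof. by move=> sf n; have [] := sf n.+1. Qed.

Lemma smooth_continuous f : smooth f -> continuous f.
Proof.
move=> sf x; apply: differentiable_continuous; apply/derivable1_diffP.
exact: smooth_derivable.
Qed.

Lemma smoothP f :
  smooth f <-> forall n x, derivable (f^`(n)) x 1.
Proof.
split=> [sf n|].
  elim: n f sf => [|n IH] f sf x; first by rewrite derive1n0; exact: smooth_derivable.
  by rewrite derive1Sn; apply: IH; exact: smooth_derive.
move=> + n; elim: n f => [//|n IH] f df; split; first exact: (df 0%N).
by apply: IH => m x; rewrite -derive1Sn.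
Qed.

Lemma smooth_measurable (A : set R) g : smooth g -> measurable_fun A g.
Proof.
move=> sg; apply: measurable_funTS; apply: continuous_measurable_fun.
exact: smooth_continuous.
Qed.

Lemma diff_timesW n f : diff_times n.+1 f -> diff_times n f.
Proof. by elim: n f => [//|n IH] f [df dn]; split => //; exact: IH. Qed.

Lemma smooth_antiderivative f g :
  (forall x, is_derive x 1 f (g x)) -> smooth g -> smooth f.
Proof.
move=> fg sg [//|n]; split; first by move=> x; case: (fg x).
suff -> : f^`() = g by exact: sg.
by apply/funext => x; exact: derive1_val.
Qed.

Lemma diff_times_cst n c : diff_times n (cst c).
Proof.
elim: n c => [//|n IH] c; split; first by move=> x; exact: derivable_cst.
suff -> : (cst c : R -> R)^`() = cst 0 by exact: IH.
by apply/funext => x; rewrite derive1_cst.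
Qed.

Lemma diff_timesD n f g :
  diff_times n f -> diff_times n g -> diff_times n (f + g).
Proof.
elim: n f g => [//|n IH] f g [df dnf] [dg dng]; split.
  by move=> x; exact: derivableD.
suff -> : derive1 (f + g) = derive1 f + derive1 g by exact: IH.
by apply/funext => x; rewrite derive1E deriveD// -!derive1E.
Qed.

Lemma diff_timesM n f g :
  diff_times n f -> diff_times n g -> diff_times n (f * g).
Proof.
elim: n f g => [//|n IH] f g hf hg; have [df dnf] := hf; have [dg dng] := hg.
split; first by move=> x; exact: derivableM.
have -> : derive1 (f * g) = f * derive1 g + g * derive1 f.
  by apply/funext => x; rewrite derive1E deriveM// -!derive1E.
by apply: diff_timesD; apply: IH => //; exact: diff_timesW.
Qed.

Lemma smooth_cst c : smooth (cst c).
Proof. by move=> n; exact: diff_times_cst. Qed.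

Lemma smoothD f g : smooth f -> smooth g -> smooth (f + g).
Proof. by move=> sf sg n; exact: diff_timesD. Qed.

Lemma smoothM f g : smooth f -> smooth g -> smooth (f * g).
Proof. by move=> sf sg n; exact: diff_timesM. Qed.

Lemma smoothZ c f : smooth f -> smooth (fun x => c * f x).
Proof. by move=> sf; exact: smoothM (smooth_cst c) sf. Qed.

Lemma smoothB f g : smooth f -> smooth g -> smooth (fun x => f x - g x).
Proof.
move=> sf sg; have := smoothD sf (smoothZ (-1) sg).
by congr smooth; apply/funext => x; rewrite /= fctE mulN1r.
Qed.

Lemma smooth_affine a c f : smooth f -> smooth (fun x => f (a * x + c)).
Proof.
move=> sf n; elim: n f sf => [//|n IH] f sf.
have df x : is_derive x 1 (fun x => f (a * x + c)) (a * derive1 f (a * x + c)).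
  have := @is_derive1_comp R f (fun x => a * x + c) x (derive1 f (a * x + c)) a.
  rewrite [a * (derive1 f _)]mulrC; apply.
    by rewrite derive1E; apply/derivableP; exact: smooth_derivable.
  apply: is_derive_eq.
  by rewrite addr0 -[_%:A]/(a * 1)  mulr1.
split; first by move=> x; case: (df x).
suff -> : (fun x => f (a * x + c))^`() = cst a * (fun x => derive1 f (a * x + c)).
  apply: diff_timesM; first exact: diff_times_cst.
  by apply: IH; exact: smooth_derive.
by apply/funext => x; exact: derive1_val.
Qed.

Lemma smooth_expR f : smooth f -> smooth (fun x => expR (f x)).
Proof.
move=> sf; elim=> [//|n IH].
have df x : is_derive x 1 (fun x => expR (f x)) (expR (f x) * derive1 f x).
  apply: is_derive1_comp.
  by rewrite derive1E; apply/derivableP; exact: smooth_derivable.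
split; first by move=> x; case: (df x).
suff -> : (fun x => expR (f x))^`() = (fun x => expR (f x)) * derive1 f.
  by apply: diff_timesM => //; exact: smooth_derive.
by apply/funext => x; exact: derive1_val.
Qed.

(** The classical flat function exp(-1/x) is [flat 0]; the extra powers of 1/x
    make the family stable under differentiation. *)
Definition flat k x := if 0 < x then x^-1 ^+ k * expR (- x^-1) else 0.

Lemma flat_ge0 k x : 0 <= flat k x.
Proof.
rewrite /flat; case: ifPn => // x0.
by rewrite mulr_ge0 ?expR_ge0// exprn_ge0// invr_ge0 ltW.
Qed.

(** The exponential beats every power: exp(1/x) >= x^-(k+1) / (k+1)!.  The bound
    is linear in x so that it yields the continuity at 0 of the difference
    quotients below. *)
Lemma flat_le k x : flat k x <= (k.+1)`!%:R * `|x|.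
Proof.
rewrite /flat; case: ifPn => x0; last by rewrite mulr_ge0.
rewrite gtr0_norm// expRN ler_pdivrMr ?expR_gt0//.
have y0 : 0 < x^-1 by rewrite invr_gt0.
have := expR_ge1Dxn k (ltW y0).
set F : R := (k.+1)`!%:R; have F0 : 0 < F by rewrite ltr0n fact_gt0.
move=> h; have : x^-1 ^+ k.+1 / F <= expR x^-1.
  by apply: le_trans h; rewrite lerDr.
rewrite ler_pdivrMr// => h1.
rewrite mulrAC -[leLHS]mulr1 -(mulVf (lt0r_neq0 x0)) mulrA -exprSr.
by rewrite ler_pM2r// mulrC.
Qed.

Lemma flat_divx k x : x^-1 * flat k x = flat k.+1 x.
Proof. by rewrite /flat; case: ifPn => x0; rewrite ?mulr0// mulrA -exprS. Qed.

(** The difference quotient of [flat k] at 0 is [flat k.+1], which tends to 0. *)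
Lemma flat_is_derive0 k : is_derive (0 : R) 1 (flat k) 0.
Proof.
suff h : h^-1 *: (flat k (h *: 1 + 0) - flat k 0) @[h --> (0:R)^'] --> (0 : R).
  by apply: DeriveDef; [apply/cvg_ex; exists 0|apply/cvg_lim].
have -> : (fun h => h^-1 *: (flat k (h *: 1 + 0) - flat k 0)) = flat k.+1.
  apply/funext => h; rewrite addr0 -[h *: 1]/(h * 1) mulr1.
  by rewrite {2}/flat ltxx subr0 -[_ *: _]/(_ * _) flat_divx.
apply: (@cvg_to_0_linear _ _ (k.+2)`!%:R 1) => // h _.
by rewrite ger0_norm ?flat_ge0// flat_le.
Qed.

Lemma flat_is_derive k x :
  is_derive x 1 (flat k) (flat k.+2 x - k%:R * flat k.+1 x).
Proof.
case: (ltrgtP x 0) => x0.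
- have f0 j : flat j x = 0 by rewrite /flat ltNge (ltW x0).
  rewrite !f0 mulr0 subr0.
  apply: (near_eq_is_derive (f := cst (0 : R))).
  near=> y; rewrite /= /flat ltNge ltW//; near: y; exact: lt_nbhsl.
- apply: (near_eq_is_derive (f := fun x => x^-1 ^+ k * expR (- x^-1))).
    near=> y; rewrite /flat ifT//; near: y; exact: lt_nbhsr.
  have xn0 : x != 0 by rewrite gt_eqF.
  have dV : is_derive x 1 (fun y : R => y^-1) (- x^-1 ^+ 2).
    have := @is_deriveV R id x 1 1 xn0 (is_derive_id x 1).
    by rewrite -[_ *: _]/(_ * _) mulr1 exprVn.
  have dE : is_derive x 1 (fun y : R => expR (- y^-1)) (expR (- x^-1) * x^-1 ^+ 2).
    apply: is_derive1_comp; have := is_deriveN dV; by rewrite opprK.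
  have powE : (fun y : R => y^-1) ^+ k = (fun y => y^-1 ^+ k).
    by apply/funext => y; elim: (k) => [|j IH]; rewrite ?expr0// !exprS -IH.
  have dX := is_deriveX k dV; rewrite powE in dX.
  have [h1 h2] := is_deriveM dX dE.
  apply: DeriveDef; [exact: h1|rewrite [LHS]h2].
  rewrite /flat x0 -![_ *: _]/(_ * _) !exprSr.
  case: k {dX powE h1 h2 } => [|k]; first by rewrite /= expr0; ring.
  by rewrite /= !exprSr; ring.
- have f0 j : flat j 0 = 0 by rewrite /flat ltxx.
  rewrite x0 !f0 mulr0 subr0; exact: flat_is_derive0.
Unshelve. all: by end_near. Qed.

Lemma smooth_flat k : smooth (flat k).
Proof.
move=> n; elim: n k => [//|n IH] k; split.
  by move=> x; case: (flat_is_derive k x).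
have -> : (flat k)^`() = flat k.+2 + cst (- k%:R) * flat k.+1.
  by apply/funext => x; rewrite (derive1_val (flat_is_derive k x)) !fctE mulNr.
by apply: diff_timesD => //; apply: diff_timesM => //; exact: diff_times_cst.
Qed.

(** The product of the two flat functions is positive exactly on ]a, b[;
    composing with y |-> 1 - exp(- n y), which is 0 at y = 0 and tends to 1 for y > 0
    as n grows, turns it into smooth approximations of the indicator of ]a, b[. *)
Definition plateau a b n x := 1 - expR (- (n%:R * (flat 0 (x - a) * flat 0 (b - x)))).

Lemma smooth_plateau a b n : smooth (plateau a b n).
Proof.
apply: (smoothB (smooth_cst 1)); apply: smooth_expR.
have s1 : smooth (fun x => flat 0 (x - a)).
  have := @smooth_affine 1 (- a) _ (smooth_flat 0).
  by congr smooth; apply/funext => x; rewrite mul1r.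
have s2 : smooth (fun x => flat 0 (b - x)).
  have := @smooth_affine (-1) b _ (smooth_flat 0).
  by congr smooth; apply/funext => x; rewrite mulN1r addrC.
have := smoothZ (- n%:R) (smoothM s1 s2).
by congr smooth; apply/funext => x; rewrite mulNr.
Qed.

Lemma plateau01 a b n x : 0 <= plateau a b n x <= 1.
Proof.
rewrite /plateau subr_ge0 lerBlDr lerDl expR_ge0 andbT.
by rewrite expR_le1 oppr_le0 !mulr_ge0// flat_ge0.
Qed.

Lemma plateau_out a b n x : ~ `]a, b[ x -> plateau a b n x = 0.
Proof.
move=> abx; rewrite /plateau; suff -> : flat 0 (x - a) * flat 0 (b - x) = 0.
  by rewrite mulr0 oppr0 expR0 subrr.
rewrite /flat !subr_gt0; case: ifPn => ax; last by rewrite mul0r.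
case: ifPn => xb; last by rewrite mulr0.
by exfalso; apply: abx; rewrite /= in_itv/= ax.
Qed.

Lemma plateau_exponent_gt0 a b x : `]a, b[ x ->
  0 < flat 0 (x - a) * flat 0 (b - x).
Proof.
rewrite /= in_itv/= => /andP[ax xb].
by rewrite /flat !subr_gt0 ax xb !expr0 !mul1r mulr_gt0 ?expR_gt0.
Qed.

Lemma plateau_gt0 a b n x : `]a, b[ x -> 0 < plateau a b n.+1 x.
Proof.
move=> /plateau_exponent_gt0 c0.
by rewrite /plateau subr_gt0 expR_lt1 oppr_lt0 mulr_gt0.
Qed.

Lemma plateau_cvg a b x : `]a, b[ x -> plateau a b n x @[n --> \oo] --> (1 : R).
Proof.
move=> /plateau_exponent_gt0; rewrite /plateau; set c := _ * _ => c0.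
rewrite -[X in _ --> X]subr0; apply: cvgB; first exact: cvg_cst.
have -> : (fun n => expR (- (n%:R * c))) = geometric 1 (expR (- c)).
  by apply/funext => n /=; rewrite mul1r -expRM_natl mulrN.
by apply: cvg_geometric; rewrite ger0_norm ?expR_ge0// expR_lt1 oppr_lt0.
Qed.

End Smooth.

(** * The weighted energy *)
Section Energy.
Context {R : realType}.
Implicit Types (f g h w : R -> R) (p : R) (D : set R).
Local Notation mu := (@lebesgue_measure R).

(** The p-th power of the weighted norm, over an arbitrary domain.  The quasi
    triangle inequality [energyD] does the work of the triangle inequality, so
    that p-th roots of extended reals appear only in the translation to
    [wLp_norm]. *)
Definition energy p w D f : \bar R :=
  (\int[mu]_(t in D) (`|f t| `^ p * w t)%:E)%E.

Lemma measurable_energy p w D f : measurable_fun D f -> measurable_fun D w ->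
  measurable_fun D (fun t : R => (`|f t| `^ p * w t)%:E : \bar R).
Proof.
move=> mf mw; apply/measurable_EFinP; apply: measurable_funM => //.
apply: (@measurableT_comp _ _ _ _ _ _ (fun x => x `^ p)).
  exact: measurable_powR.
exact: measurableT_comp.
Qed.

Lemma energy_ge0 p w D f : (forall t, D t -> 0 <= w t) ->
  (0 <= energy p w D f)%E.
Proof.
move=> w0; apply: integral_ge0 => t Dt.
by rewrite lee_fin mulr_ge0 ?powR_ge0// w0.
Qed.

Lemma le_energy p w D f g : 0 <= p -> measurable D ->
  (forall t, D t -> 0 <= w t) -> measurable_fun D w ->
  measurable_fun D f -> measurable_fun D g ->
  (forall t, D t -> `|f t| <= `|g t|) ->
  (energy p w D f <= energy p w D g)%E.
Proof.
move=> p0 mD w0 mw mf mg fg; apply: ge0_le_integral => //.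
- by move=> t Dt; rewrite lee_fin mulr_ge0 ?powR_ge0// w0.
- exact: measurable_energy.
- exact: measurable_energy.
- move=> t Dt; rewrite lee_fin ler_wpM2r ?w0//.
  by apply: ge0_ler_powR; rewrite ?nnegrE// fg.
Qed.

Lemma eq_energy p w D f g : (forall t, D t -> f t = g t) ->
  energy p w D f = energy p w D g.
Proof. by move=> fg; apply: eq_integral => t; rewrite inE => /fg ->. Qed.

Lemma energy_support p w (D E : set R) f : 0 < p -> D `<=` E ->
  (forall t, E t -> ~ D t -> f t = 0) -> energy p w E f = energy p w D f.
Proof.
move=> p0 DE f0; rewrite /energy integral_mkcond [RHS]integral_mkcond.
apply: eq_integral => t _; rewrite /patch.
have [Dt|Dt] := boolP (t \in D).
  by rewrite ifT//; apply/mem_set/DE/set_mem.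
case: ifPn => // /set_mem Et; rewrite f0//; last by move/mem_set; exact/negP.
by rewrite normr0 powR0 ?gt_eqF// mul0r.
Qed.

Lemma energy_distC p w D f g :
  energy p w D (fun t => f t - g t) = energy p w D (fun t => g t - f t).
Proof. by apply: eq_integral => t _; rewrite distrC. Qed.

(** The sum is at most twice the larger term. *)
Lemma powRD_le p (x y : R) : 0 <= p -> 0 <= x -> 0 <= y ->
  (x + y) `^ p <= 2 `^ p * (x `^ p + y `^ p).
Proof.
move=> p0 x0 y0.
have [xy|yx] := leP x y.
- apply: (@le_trans _ _ ((2 * y) `^ p)).
    apply: ge0_ler_powR; rewrite ?nnegrE ?addr_ge0 ?mulr_ge0//; lra.
  by rewrite powRM// ler_wpM2l ?powR_ge0// lerDr powR_ge0.
- apply: (@le_trans _ _ ((2 * x) `^ p)).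
    apply: ge0_ler_powR; rewrite ?nnegrE ?addr_ge0 ?mulr_ge0//; lra.
  by rewrite powRM// ler_wpM2l ?powR_ge0// lerDl powR_ge0.
Qed.

Lemma energyD p w D f g : 0 <= p -> measurable D ->
  (forall t, D t -> 0 <= w t) -> measurable_fun D w ->
  measurable_fun D f -> measurable_fun D g ->
  (energy p w D (fun t => f t + g t)%R
    <= (2 `^ p)%:E * (energy p w D f + energy p w D g))%E.
Proof.
move=> p0 mD w0 mw mf mg.
rewrite /energy -ge0_integralD//; last 4 first.
- by move=> t Dt; rewrite lee_fin mulr_ge0 ?powR_ge0// w0.
- exact: measurable_energy.
- by move=> t Dt; rewrite lee_fin mulr_ge0 ?powR_ge0// w0.
- exact: measurable_energy.
rewrite -ge0_integralZl_EFin//; last 2 first.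
- by move=> t Dt; rewrite -EFinD lee_fin addr_ge0// mulr_ge0 ?powR_ge0// w0.
- by apply: emeasurable_funD; exact: measurable_energy.
apply: ge0_le_integral => //.
- by move=> t Dt; rewrite lee_fin mulr_ge0 ?powR_ge0// w0.
- by apply: measurable_energy => //; exact: measurable_funD.
- by apply/measurable_funeM/emeasurable_funD; exact: measurable_energy.
- move=> t Dt; rewrite -EFinD -EFinM lee_fin -mulrDl mulrA.
  rewrite ler_wpM2r ?w0//; apply: le_trans (powRD_le _ _ _) => //.
  apply: ge0_ler_powR; rewrite ?nnegrE ?addr_ge0//; exact: ler_normD.
Qed.

Lemma energyZ p w D c f : measurable D ->
  (forall t, D t -> 0 <= w t) -> measurable_fun D w -> measurable_fun D f ->
  energy p w D (fun t => c * f t) = ((`|c| `^ p)%:E * energy p w D f)%E.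
Proof.
move=> mD w0 mw mf; rewrite /energy -ge0_integralZl_EFin//; last 2 first.
- by move=> t Dt; rewrite lee_fin mulr_ge0 ?powR_ge0// w0.
- exact: measurable_energy.
by apply: eq_integral => t _; rewrite normrM powRM// -mulrA -EFinM.
Qed.

(** Dominated convergence with dominating function |h|^p w. *)
Lemma energy_dominated p w D (F : nat -> R -> R) h : 1 <= p -> measurable D ->
  (forall t, D t -> 0 <= w t) -> measurable_fun D w ->
  (forall n, measurable_fun D (F n)) -> measurable_fun D h ->
  (forall t, D t -> F n t @[n --> \oo] --> (0 : R)) ->
  (forall n t, D t -> `|F n t| <= `|h t|) ->
  (energy p w D h < +oo)%E ->
  forall e, 0 < e -> exists n, (energy p w D (F n) < e%:E)%E.
Proof.
move=> p1 mD w0 mw mF mh F0 Fh hfin e e0.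
have p0 : 0 <= p by exact: le_trans p1.
have [] := @dominated_convergence _ _ _ mu D mD
    (fun n t => (`|F n t| `^ p * w t)%:E) (cst 0%E)
    (fun t => (`|h t| `^ p * w t)%:E).
- by move=> n; exact: measurable_energy.
- exact: measurable_cst.
- apply: aeW => t Dt; apply: cvg_EFin; first by apply: nearW.
  rewrite -[X in _ --> X](mul0r (w t)); apply: cvgM; last exact: cvg_cst.
  have Fn0 : `|F n t| @[n --> \oo] --> (0 : R).
    by rewrite -(@normr0 _ R); apply: cvg_norm; exact: F0.
  apply: (@squeeze_cvgr _ _ _ _ (cst 0) (fun n => `|F n t|)) => //; last first.
    exact: cvg_cst.
  have : \forall n \near \oo, `|F n t| < 1.
    by apply: (cvgr_lt (0 : R)) => //; exact: Fn0.
  apply: filterS => n Fn1; rewrite powR_ge0/=.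
  have [->|Fn] := eqVneq `|F n t| 0.
    by rewrite powR0// gt_eqF// (lt_le_trans ltr01).
  by apply: ge1r_powR => //; rewrite lt0r Fn normr_ge0 ltW.
- apply/integrableP; split; first exact: measurable_energy.
  under eq_integral => t /[!inE] Dt.
    rewrite gee0_abs; last by rewrite lee_fin mulr_ge0 ?powR_ge0// w0.
    over.
  exact: hfin.
- apply: aeW => t n Dt; rewrite gee0_abs; last first.
    by rewrite lee_fin mulr_ge0 ?powR_ge0// w0.
  rewrite lee_fin ler_wpM2r ?w0//.
  by apply: ge0_ler_powR; rewrite ?nnegrE// Fh.
move=> _ _; rewrite integral0 => /fine_cvgP[Ffin].
move=> /(@cvgr_lt _ _ _ _ _ _)/(_ _ e0) Fe.
near \oo => n; exists n.
have nf : energy p w D (F n) \is a fin_num by near: n; exact: Ffin.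
rewrite -(fineK nf) lte_fin.
by near: n; exact: Fe.
Unshelve. all: by end_near. Qed.

(** The bookkeeping of constants in every use of [energyD]. *)
Lemma lte_mul_half (c e : R) (X Y : \bar R) : 0 < c ->
  (X < (e / (c * 2))%:E -> Y < (e / (c * 2))%:E -> c%:E * (X + Y) < e%:E)%E.
Proof.
move=> c0 Xd Yd; have -> : e = c * (e / (c * 2) + e / (c * 2)).
  by field; rewrite gt_eqF.
by rewrite [ltRHS]EFinM lte_pmul2l// [ltRHS]EFinD lteD.
Qed.

Lemma wLp_norm_lt p w f (e : R) : 0 < p -> 0 < e ->
  (wLp_norm p w f < (e `^ p^-1)%:E)%E -> (energy p w Rpos f < e%:E)%E.
Proof.
move=> p0 e0; rewrite !ltNge; apply: contra => eE.
rewrite /wLp_norm -poweR_EFin; apply: gt0_ler_poweR => //.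
- by rewrite invr_ge0 ltW.
- by rewrite in_itv/= lee_fin ltW// leey.
- by rewrite in_itv/= leey andbT (le_trans _ eE)// lee_fin ltW.
Qed.

Lemma wLp_norm_le p w f (e : R) : 0 < p -> 0 <= e -> (0 <= energy p w Rpos f)%E ->
  (energy p w Rpos f < (e `^ p)%:E)%E -> (wLp_norm p w f <= e%:E)%E.
Proof.
move=> p0 e0 f0 fe.
have -> : e = (e `^ p) `^ p^-1 by rewrite -powRrM mulfV ?gt_eqF// powRr1.
rewrite /wLp_norm -poweR_EFin; apply: gt0_ler_poweR => //.
- by rewrite invr_ge0 ltW.
- by rewrite in_itv/= leey f0.
- by rewrite in_itv/= leey lee_fin powR_ge0.
- exact: ltW.
Qed.

Lemma wLp_norm_lty p w f : 0 < p ->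
  (wLp_norm p w f < +oo)%E <-> (energy p w Rpos f < +oo)%E.
Proof.
move=> p0; split; last exact: poweR_lty.
by apply: lty_poweRy; rewrite invr_eq0 gt_eqF.
Qed.

(** The form in which the convergence of the derivatives of an approximating
    sequence is used. *)
Lemma wLp_norm_cvg0 p w (F : nat -> R -> R) (d : R) : 0 < p -> 0 < d ->
  wLp_norm p w (F n) @[n --> \oo] --> 0%E ->
  \forall n \near \oo, (energy p w Rpos (F n) < d%:E)%E.
Proof.
move=> p0 d0 /fine_cvgP[Ffin F0].
have dp : 0 < d `^ p^-1 by exact: powR_gt0.
have Fd := cvgr_lt _ F0 _ dp.
near=> n; apply: wLp_norm_lt => //.
have nf : wLp_norm p w (F n) \is a fin_num by near: n; exact: Ffin.
by rewrite -(fineK nf) lte_fin; near: n; exact: Fd.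
Unshelve. all: by end_near. Qed.

End Energy.

(** * Density of smooth functions on a bounded interval *)
Section Density.
Context {R : realType}.
Implicit Types (f g h : R -> R) (A : set R).
Context (p : R) (w : R -> R) (a b : R).
Let D : set R := `]a, b[%classic.
Context (p1 : 1 <= p) (w0 : forall t, D t -> 0 <= w t).
Context (mw : measurable_fun D w) (wfin : (energy p w D (cst 1%R) < +oo)%E).

Let p0 : 0 <= p. Proof. exact: le_trans p1. Qed.
Let mD : measurable D. Proof. exact: measurable_itv. Qed.

(** The approximants vanish off ]a, b[ itself: an approximation from a larger
    support would control the energy but not the integral of the approximant. *)
Definition approximable f := measurable_fun D f /\
  forall e, 0 < e -> exists g, [/\ smooth g, forall t, ~ D t -> g t = 0 &
    (energy p w D (fun t => f t - g t)%R < e%:E)%E].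

Lemma approximable_closed f : measurable_fun D f ->
  (forall e, 0 < e -> exists2 f', approximable f' &
    (energy p w D (fun t => f t - f' t)%R < e%:E)%E) -> approximable f.
Proof.
move=> mf H; split=> // e e0.
have c0 : 0 < (2 : R) `^ p by exact: powR_gt0.
pose d := e / (2 `^ p * 2).
have d0 : 0 < d by rewrite divr_gt0// mulr_gt0.
have [f' [mf' af'] ff'] := H d d0.
have [g [sg g0 f'g]] := af' d d0.
exists g; split => //.
rewrite (_ : (fun t => f t - g t) = (fun t => (f t - f' t) + (f' t - g t))).
  apply: le_lt_trans (energyD p0 mD w0 mw _ _) _.
  - exact: measurable_funB.
  - by apply: measurable_funB => //; exact: smooth_measurable.
  exact: (lte_mul_half c0 ff' f'g).
by apply/funext => t; rewrite addrA subrK.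
Qed.

Lemma approximable_ext f g : approximable f -> (forall t, D t -> f t = g t) ->
  approximable g.
Proof.
move=> [mf af] fg; split.
  by apply: eq_measurable_fun mf => t; rewrite inE; exact: fg.
move=> e /af[h [sh h0 fh]]; exists h; split; [exact: sh|exact: h0|].
by rewrite (eq_energy _ _ (g := fun t => f t - h t)); [exact: fh|move=> t Dt; rewrite fg].
Qed.

Lemma approximable_smooth g : smooth g -> (forall t, ~ D t -> g t = 0) ->
  approximable g.
Proof.
move=> sg g0; split; first exact: smooth_measurable.
move=> e e0; exists g; split => //; rewrite (eq_energy _ _ (g := cst 0)).
  rewrite /energy; under eq_integral do
    rewrite normr0 powR0 ?gt_eqF ?(lt_le_trans ltr01)// mul0r.
  by rewrite integral0 lte_fin.
by move=> t _; rewrite subrr.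
Qed.

Lemma approximableD f g : approximable f -> approximable g ->
  approximable (fun t => f t + g t).
Proof.
move=> [mf af] [mg ag]; split=> [|e e0]; first exact: measurable_funD.
have c0 : 0 < (2 : R) `^ p by exact: powR_gt0.
pose d := e / (2 `^ p * 2).
have d0 : 0 < d by rewrite divr_gt0// mulr_gt0.
have [f' [sf' f'0 ff']] := af d d0.
have [g' [sg' g'0 gg']] := ag d d0.
exists (f' + g'); split; first exact: smoothD.
  by move=> t Dt; rewrite !fctE f'0// g'0// addr0.
rewrite (_ : (fun t => _ - _) = (fun t => (f t - f' t) + (g t - g' t))).
  apply: le_lt_trans (energyD p0 mD w0 mw _ _) _.
  - by apply: measurable_funB => //; exact: smooth_measurable.
  - by apply: measurable_funB => //; exact: smooth_measurable.
  exact: (lte_mul_half c0 ff' gg').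
by apply/funext => t; rewrite !fctE opprD addrACA.
Qed.

Lemma approximableZ c f : approximable f -> approximable (fun t => c * f t).
Proof.
move=> [mf af]; split=> [|e e0]; first exact: measurable_funM.
have c0 : 0 < `|c| `^ p + 1 by rewrite ltr_wpDl ?powR_ge0.
pose d := e / (`|c| `^ p + 1).
have d0 : 0 < d by rewrite divr_gt0.
have [f' [sf' f'0 ff']] := af d d0.
exists (fun t => c * f' t); split; first exact: smoothZ.
  by move=> t Dt; rewrite f'0// mulr0.
rewrite (_ : (fun t => _ - _) = (fun t => c * (f t - f' t))); last first.
  by apply/funext => t; rewrite mulrBr.
rewrite energyZ//; last by apply: measurable_funB => //; exact: smooth_measurable.
apply: (@le_lt_trans _ _ ((`|c| `^ p)%:E * d%:E)%E).
  by rewrite lee_wpmul2l ?lee_fin ?powR_ge0// ltW.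
by rewrite -EFinM lte_fin /d mulrA ltr_pdivrMr// mulrC ltr_pM2l// ltrDl.
Qed.

Lemma approximableB f g : approximable f -> approximable g ->
  approximable (fun t => f t - g t).
Proof.
move=> af ag; apply: (approximable_ext (approximableD af (approximableZ (-1) ag))).
by move=> t _; rewrite mulN1r.
Qed.

(** On ]a, b[ a ray is an open interval with right end b, and [plateau]
    converges pointwise to the indicator of an open interval. *)
Lemma approximable_itv c : approximable \1_(`]c, +oo[%classic : set R).
Proof.
apply: approximable_closed => [|e e0]; first exact: measurable_indic.
pose c' := Num.max a c.
pose F n t : R := plateau c' b n t.
have DcE t : D t -> (\1_`]c, +oo[ t : R) = \1_`]c', b[ t.
  rewrite /D/= in_itv/= => /andP[ta tb]; rewrite !indicE !mem_setE.
  by rewrite !in_itv/= tb andbT andbT /c' gt_max ta.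
have [n Fn] : exists n, (energy p w D (fun t => \1_`]c, +oo[ t - F n t)%R < e%:E)%E.
  apply: (energy_dominated (F := fun n t => \1_`]c, +oo[ t - F n t)
    p1 mD w0 mw _ _ _ _ wfin e0) => //.
- move=> n; apply: measurable_funB; first exact: measurable_indic.
  by apply: smooth_measurable; exact: smooth_plateau.
- move=> t Dt; rewrite DcE// indicE.
  have [tc|tc] := boolP (t \in `]c', b[%classic).
    rewrite -(subrr (1 : R)); apply: cvgB; first exact: cvg_cst.
    by apply: plateau_cvg; rewrite -inE.
  have tn : ~ `]c', b[ t by move/mem_set; exact/negP.
  by under eq_fun do rewrite /F plateau_out// subr0; exact: cvg_cst.
- move=> n t Dt; rewrite normr1 DcE// indicE.
  have /andP[P0 P1] := plateau01 c' b n t.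
  have [tc|tc] := boolP (t \in `]c', b[%classic).
    by rewrite /F ger0_norm ?subr_ge0// lerBlDr lerDl.
  by rewrite /F plateau_out ?subr0 ?normr0//; move/mem_set; exact/negP.
exists (F n) => //; apply: approximable_smooth; first exact: smooth_plateau.
move=> t Dt; apply: plateau_out => /=; rewrite in_itv/= gt_max => /andP[/andP[ta _] tb].
by apply: Dt; rewrite /D/= in_itv/= ta.
Qed.

(** Pi-lambda argument: open rays form a pi-system generating the Borel sets,
    and the sets with approximable indicator form a lambda-system. *)
Lemma approximable_indic A : measurable A -> approximable \1_A.
Proof.
pose H := [set A : set R | measurable A /\ approximable \1_A].
suff : measurable `<=` H by move=> /[apply] -[].
have -> : (measurable : set (set R)) = <<s @RGenOInfty.G R >>.
  exact: RGenOInfty.measurableE.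
apply: lambda_system_subset => //.
- move=> _ _ [x ->] [y ->]; exists (Num.max x y).
  by apply/seteqP; split => t /=; rewrite !in_itv/= !andbT gt_max;
    [move=> [-> ->]|move=> /andP].
- split; first by move=> *; exact: subsetT.
  + split => //; apply: (approximable_ext (approximable_itv a)) => t.
    by rewrite /D/= in_itv/= => /andP[ta _]; rewrite indicT/= indicE mem_set//= in_itv/= ta.
  + move=> A' B' BA [mA aA] [mB aB]; split; first exact: measurableD.
    apply: (approximable_ext (approximableB aA aB)) => t _.
    rewrite !indicE in_setD; have [tB|tB] := boolP (t \in B') => /=.
      by rewrite mem_set ?subrr//; apply: BA; exact: set_mem.
    by rewrite subr0 andbT.
  + move=> F ndF HF.
    have mF : measurable (\bigcup_n F n).
      by apply: bigcup_measurable => n _; case: (HF n).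
    split => //; apply: approximable_closed => [|e e0]; first exact: measurable_indic.
    have [n Fn] : exists n,
        (energy p w D (fun t => \1_(\bigcup_n F n) t - \1_(F n) t)%R < e%:E)%E.
      apply: (energy_dominated (F := fun n t => \1_(\bigcup_n F n) t - \1_(F n) t)
        p1 mD w0 mw _ _ _ _ wfin e0) => //.
    * move=> n; apply: measurable_funB; apply: measurable_indic => //.
      by case: (HF n).
    * move=> t Dt; have [/set_mem[k _ Fk]|tF] := boolP (t \in \bigcup_n F n).
        apply: cvg_near_cst; near=> n.
        have kn : (k <= n)%N by near: n; exact: nbhs_infty_ge.
        have Fn : F n t by move: Fk; apply/subsetPset; exact: ndF.
        by rewrite !indicE mem_set ?mem_set ?subrr//; exists n.
      have tn n : t \notin F n.
        by apply: contra tF => /set_mem Fn; apply/mem_set; exists n.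
      under eq_fun do rewrite !indicE (negbTE tF) (negbTE (tn _)) subr0.
      exact: cvg_cst.
    * move=> n t Dt; rewrite !indicE normr1.
      have [tFn|tFn] := boolP (t \in F n).
        rewrite mem_set ?subrr ?normr0//.
        by exists n => //; exact: set_mem.
      by rewrite subr0; case: (_ \in _); rewrite ?normr1 ?normr0.
    by exists \1_(F n) => //; case: (HF n).
- by move=> _ [x ->]; split; [exact: measurable_itv|exact: approximable_itv].
Unshelve. all: by end_near. Qed.

Import HBNNSimple.

Lemma approximable_nnsfun (f : {nnsfun R >-> R}) : approximable f.
Proof.
have -> : (f : R -> R) =
    (fun t => \sum_(y <- finmap.enum_fset (fset_set (range f))) y * \1_(f @^-1` [set y]) t).
  by apply/funext => t; rewrite fimfunE fsbig_finite.
elim: (finmap.enum_fset _) => [|y s IH].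
  apply: (approximable_ext (@approximable_smooth (cst 0) _ _)) => //.
    exact: smooth_cst.
  by move=> t _; rewrite big_nil.
apply: (approximable_ext (approximableD
  (approximableZ y (@approximable_indic (f @^-1` [set y]) _)) IH)) => [|t _].
  exact: measurable_sfunP.
by rewrite big_cons.
Qed.

(** Monotone approximation by simple functions; f itself dominates the errors. *)
Lemma approximable_ge0 f : measurable_fun D f -> (forall t, D t -> 0 <= f t) ->
  (energy p w D f < +oo)%E -> approximable f.
Proof.
move=> mf f0 ffin; apply: approximable_closed => // e e0.
have mEf : measurable_fun D (EFin \o f) by exact/measurable_EFinP.
have Ef0 : forall t, D t -> (0 <= (EFin \o f) t)%E by move=> t /f0; rewrite lee_fin.
pose F := nnsfun_approx mD mEf.
have cF t : D t -> F n t @[n --> \oo] --> f t.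
  by move=> Dt; have /fine_cvgP[] := @cvg_nnsfun_approx _ _ _ _ mD _ mEf Ef0 t Dt.
have Ff n t : D t -> F n t <= f t.
  move=> Dt; have := cF _ Dt => /cvg_lim <- //.
  apply: nondecreasing_cvgn_le; last by apply/cvg_ex; exists (f t); exact: cF.
  by move=> i j ij; exact/lefP/nd_nnsfun_approx.
have [n Fn] : exists n, (energy p w D (fun t => f t - F n t)%R < e%:E)%E.
  apply: (energy_dominated (F := fun n t => f t - F n t)
    p1 mD w0 mw _ mf _ _ ffin e0) => //.
- by move=> n; apply: measurable_funB => //; apply: measurable_funTS.
- move=> t Dt; rewrite -(subrr (f t)); apply: cvgB; first exact: cvg_cst.
  exact: cF.
- move=> n t Dt; rewrite !ger0_norm ?subr_ge0 ?f0 ?Ff//.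
  by rewrite lerBlDr lerDl.
by exists (F n) => //; exact: approximable_nnsfun.
Qed.

Lemma approximable_energy f : measurable_fun D f ->
  (energy p w D f < +oo)%E -> approximable f.
Proof.
move=> mf ffin.
have mfp := measurable_funrpos mf; have mfn := measurable_funrneg mf.
have hn t : `|f t| = f^\+ t + f^\- t by have /(congr1 (@^~ t)) := funrposDneg f.
apply: (approximable_ext (f := fun t => f^\+ t - f^\- t)); last first.
  by move=> t _; have /(congr1 (@^~ t)) := funrposBneg f.
apply: approximableB.
- apply: (approximable_ge0 mfp _ _) => [t _|]; first exact: funrpos_ge0.
  apply: le_lt_trans ffin; apply: (le_energy p0 mD w0 mw mfp mf _) => t _.
  by rewrite hn ger0_norm ?lerDl ?funrpos_ge0 ?funrneg_ge0.
- apply: (approximable_ge0 mfn _ _) => [t _|]; first exact: funrneg_ge0.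
  apply: le_lt_trans ffin; apply: (le_energy p0 mD w0 mw mfn mf _) => t _.
  by rewrite hn ger0_norm ?lerDr ?funrpos_ge0 ?funrneg_ge0.
Qed.

End Density.

(** * Primitives and test functions *)
Section Primitive.
Context {R : realType}.
Implicit Types (f g u phi : R -> R) (a b t : R).
Local Notation mu := (@lebesgue_measure R).

(** Integrating from -oo makes the fundamental theorem of calculus available at
    every real point, including 0 and the negative ones. *)
Definition primitive g t : R := (\int[mu]_(s in `]-oo, t]) g s)%R.

Lemma integrableZl_EFin (A : set R) (c : R) f : measurable A ->
  mu.-integrable A (EFin \o f) -> mu.-integrable A (EFin \o (fun t => c * f t)).
Proof.
move=> mA fi.
have : mu.-integrable A (fun t => c%:E * (EFin \o f) t)%E by exact: integrableZl.
by apply: eq_integrable => // t _; rewrite /= EFinM.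
Qed.

Lemma Rintegral_support (A B D : set R) g : A `&` D = B `&` D ->
  (forall t, ~ D t -> g t = 0) ->
  (\int[mu]_(s in A) g s = \int[mu]_(s in B) g s)%R.
Proof.
move=> AB g0; rewrite Rintegral_mkcond [RHS]Rintegral_mkcond.
congr (Rintegral _ _); apply/funext => s; rewrite /patch.
have [Ds|/g0 ->] := pselect (D s); last by case: ifP; case: ifP.
suff -> : (s \in A) = (s \in B) by [].
by apply/idP/idP => /set_mem ?; apply/mem_set;
  [have : (B `&` D) s by rewrite -AB|have : (A `&` D) s by rewrite AB]; case.
Qed.

Section Supported.
Context (g : R -> R) (a b : R).
Context (sg : smooth g) (g0 : forall t, ~ `]a, b[%classic t -> g t = 0).

Lemma supported_integrable (A : set R) : measurable A ->
  mu.-integrable A (EFin \o g).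
Proof.
move=> mA; apply: (@integrableS _ _ _ _ setT) => //.
have -> : EFin \o g = (EFin \o g) \_ `[a, b]%classic.
  apply/funext => t; rewrite /patch; case: ifPn => //= tab; rewrite g0//.
  apply: contraNnot tab => tab; apply/mem_set; exact: subset_itv_oo_cc.
apply/(integrable_mkcond _ _).1 => //; apply: continuous_compact_integrable.
  exact: segment_compact.
by apply: continuous_subspaceT; exact: smooth_continuous.
Qed.

Lemma primitive_is_derive t : is_derive t 1 (primitive g) (g t).
Proof.
have [dF F'] : derivable (primitive g) t 1 /\ derive1 (primitive g) t = g t.
  apply: (@continuous_FTC1 R g -oo%O t (t + 1)) => //.
  - by rewrite ltrDl.
  - exact: supported_integrable.
  - exact: ltNyr.
  - exact: smooth_continuous.
by apply: DeriveDef; [exact: dF|rewrite -derive1E].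
Qed.

Lemma primitive_derive1 : derive1 (primitive g) = g.
Proof. by apply/funext => t; exact: derive1_val (primitive_is_derive t). Qed.

Lemma primitive_smooth : smooth (primitive g).
Proof. exact: (smooth_antiderivative primitive_is_derive). Qed.

Lemma primitive_left t : t <= a -> primitive g t = 0.
Proof.
move=> ta; rewrite /primitive (Rintegral_support (B := set0) _ g0).
  exact: Rintegral_set0.
rewrite set0I; apply/seteqP; split => s //= [].
rewrite !in_itv/= => st /andP[as_ _].
by have := le_lt_trans (le_trans st ta) as_; rewrite ltxx.
Qed.

Lemma primitive_right t : b <= t -> primitive g t = (\int[mu]_(s in setT) g s)%R.
Proof.
move=> bt; apply: (Rintegral_support _ g0).
apply/seteqP; split => s //= [] // _; rewrite !in_itv/= => /andP[as_ sb].
by split; [exact: le_trans (ltW sb) bt|rewrite as_].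
Qed.

Lemma primitive_pos t : 0 <= a -> primitive g t = (\int[mu]_(s in `]0%R, t]) g s)%R.
Proof.
move=> a0; apply: (Rintegral_support _ g0).
apply/seteqP; split => s /= []; rewrite !in_itv/=.
- by move=> st /andP[as_ sb]; rewrite as_ sb st (le_lt_trans a0 as_).
- by move=> /andP[_ ->].
Qed.

(** To the right of b the primitive is constant, equal to the total integral:
    compactness of the support is exactly the vanishing of that integral. *)
Lemma primitive_test_function : 0 < a ->
  (\int[mu]_(s in setT) g s)%R = 0 -> test_function (primitive g).
Proof.
move=> a0 total0.
have sub : closure [set t | primitive g t != 0] `<=` `[a, b]%classic.
  rewrite [X in _ `<=` X](closure_id _).1; last exact: itv_closed.
  apply: closureS => t /= /eqP gt.
  rewrite in_itv/=; apply/andP; split; rewrite leNgt; apply/negP => h; apply: gt.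
    by rewrite primitive_left// ltW.
  by rewrite primitive_right ?total0// ltW.
split.
- exact/smoothP/primitive_smooth.
- apply: (subclosed_compact _ (@segment_compact _ a b)) => //.
  exact: closed_closure.
- move=> t /sub; rewrite /Rpos /= !in_itv/= andbT => /andP[at_ _].
  exact: lt_le_trans at_.
Qed.

End Supported.

Lemma test_function_smooth u : test_function u -> smooth u.
Proof. by case=> /smoothP. Qed.

Lemma test_function_bounded_support u : test_function u ->
  exists b, forall t, b < t -> u t = 0.
Proof.
move=> [_ /compact_bounded[M [_ HM]] _].
exists (M + 1) => t Mt; apply/eqP; apply: contraT => ut.
have := HM (M + 1) _ t (@subset_closure _ [set x | u x != 0] t ut).
rewrite ltrDl ltr01 => /(_ isT) => h.
have := le_lt_trans (le_trans (ler_norm t) h) Mt.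
by rewrite ltxx.
Qed.

(** A test function vanishes at 0 because its closed support lies in ]0, +oo[. *)
Lemma test_function_integral u t : test_function u -> 0 < t ->
  u t = (\int[mu]_(s in `]0%R, t]) derive1 u s)%R.
Proof.
move=> tu t0; have su := test_function_smooth tu.
have cu' : continuous (derive1 u) by exact: smooth_continuous (smooth_derive su).
have u0 : u 0 = 0.
  apply/eqP; apply: contraT => u0; have [_ _ /(_ 0)] := tu.
  by move=> /(_ (@subset_closure _ [set x | u x != 0] 0 u0)); rewrite /Rpos/= in_itv/= ltxx.
have := @continuous_FTC2 R (derive1 u) u 0 t t0.
rewrite -integral_itv_obnd_cbnd; last first.
  apply/measurable_EFinP; exact: smooth_measurable (smooth_derive su).
rewrite /Rintegral => ->.
- by rewrite u0 sube0.
- exact: continuous_subspaceT.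
- split.
  + by move=> x _; exact: smooth_derivable.
  + exact/cvg_at_right_filter/smooth_continuous.
  + exact/cvg_at_left_filter/smooth_continuous.
- by [].
Qed.

Lemma test_function_dist phi f t : test_function phi -> 0 < t ->
  mu.-integrable `]0, t] (EFin \o f) ->
  (`|phi t - \int[mu]_(s in `]0, t]) f s|%:E <=
   \int[mu]_(s in `]0%R, t]) `|derive1 phi s - f s|%:E)%E.
Proof.
move=> tphi t0 fi; rewrite (test_function_integral tphi t0).
have sphi' := smooth_derive (test_function_smooth tphi).
have mA : measurable `]0, t]%classic by exact: measurable_itv.
have phi'i : mu.-integrable `]0, t] (EFin \o derive1 phi).
  apply: (@integrableS _ _ _ mu `[0, t]%classic) => //.
    by apply: subset_itv; rewrite bnd_simp.
  apply: continuous_compact_integrable; first exact: segment_compact.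
  by apply: continuous_subspaceT; exact: smooth_continuous.
have di : mu.-integrable `]0, t] (EFin \o (fun s => derive1 phi s - f s)).
  have : mu.-integrable `]0, t] ((EFin \o derive1 phi) \- (EFin \o f))%E.
    exact: integrableB.
  by apply: eq_integrable => // s _; rewrite /= EFinB.
rewrite -RintegralB// EFin_normr_Rintegral//.
by apply: le_abse_integral => //; case/integrableP: di.
Qed.

End Primitive.

(** * The dual weight and control of the L^1 norm *)
Section DualWeight.
Context {R : realType}.
Implicit Types (f g w : R -> R) (p s x y : R) (A D : set R).
Local Notation mu := (@lebesgue_measure R).

Definition dual_weight p w (t : R) := w t `^ (- (p - 1)^-1).

Lemma dual_weight_ge0 p w t : 0 <= dual_weight p w t.
Proof. exact: powR_ge0. Qed.

(** The relation v^(p-1) w = 1 defining the dual weight. *)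
Lemma powR_dual p y : 1 < p -> 0 < y ->
  (y `^ (- (p - 1)^-1)) `^ (p - 1) * y = 1.
Proof.
move=> p1 y0; rewrite -powRrM mulNr mulVf ?gt_eqF ?subr_gt0// powR_inv1 ?ltW//.
by rewrite mulVf// gt_eqF.
Qed.

(** Either x is below s v, v being the dual power of y, or x^(p-1) exceeds
    (s v)^(p-1) = s^(p-1) / y.  The free parameter s replaces the optimisation in
    Hoelder's inequality. *)
Lemma le_dual p s x y : 1 < p -> 0 < s -> 0 <= x -> 0 < y ->
  x <= s * y `^ (- (p - 1)^-1) + s `^ (1 - p) * (x `^ p * y).
Proof.
move=> p1 s0 x0 y0; set v := y `^ _.
have q0 : 0 < p - 1 by rewrite subr_gt0.
have v0 : 0 < v by exact: powR_gt0.
have sv0 : 0 <= s * v by rewrite mulr_ge0// ltW.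
have t0 : 0 <= s `^ (1 - p) * (x `^ p * y).
  by rewrite !mulr_ge0 ?powR_ge0// ltW.
have [xs|sx] := leP x (s * v); first by rewrite (le_trans xs)// lerDl.
have xp : 0 < x by exact: le_lt_trans sx.
have h : (s * v) `^ (p - 1) <= x `^ (p - 1).
  by apply: ge0_ler_powR; rewrite ?nnegrE// ltW.
have vy : v `^ (p - 1) * y = 1 by exact: powR_dual.
apply: (@le_trans _ _ (s `^ (1 - p) * (x `^ p * y))); last by rewrite lerDr.
rewrite -(mulr_powRB1 (ltW xp) (lt_trans ltr01 p1)) -mulrA mulrCA ler_peMr//.
have e1 : s `^ (1 - p) * ((s * v) `^ (p - 1) * y) = 1.
  rewrite powRM ?ltW// -mulrA vy mulr1 -powRD; last by rewrite (gt_eqF s0) implybT.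
  by rewrite addrA subrK subrr powRr0.
by rewrite -[leLHS]e1 ler_wpM2l ?powR_ge0// ler_wpM2r// ltW.
Qed.

Section Control.
Context (p : R) (w : R -> R) (A : set R).
Context (p1 : 1 < p) (mA : measurable A).
Context (w0 : forall t, A t -> 0 < w t) (mw : measurable_fun A w).
Local Notation v := (dual_weight p w).
Context (vfin : (\int[mu]_(t in A) (v t)%:E < +oo)%E).

Lemma measurable_dual_weight : measurable_fun A v.
Proof.
exact: (@measurableT_comp _ _ _ _ _ _ (fun x => x `^ _)).
Qed.

Lemma L1_le_energy f s : measurable_fun A f -> 0 < s ->
  (\int[mu]_(t in A) `|f t|%:E <=
   s%:E * \int[mu]_(t in A) (v t)%:E + (s `^ (1 - p))%:E * energy p w A f)%E.
Proof.
move=> mf s0.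
have v0 t : A t -> (0 <= (v t)%:E)%E by rewrite lee_fin dual_weight_ge0.
have mv : measurable_fun A (EFin \o v).
  by apply/measurable_EFinP; exact: measurable_dual_weight.
have e0 t : A t -> (0 <= (`|f t| `^ p * w t)%:E)%E.
  by move=> At; rewrite lee_fin mulr_ge0 ?powR_ge0// ltW// w0.
have me := measurable_energy p mf mw.
rewrite /energy -ge0_integralZl_EFin//; last exact: ltW.
rewrite -ge0_integralZl_EFin ?powR_ge0//.
rewrite -ge0_integralD//.
- apply: ge0_le_integral => //.
  + by apply/measurable_EFinP; exact: measurableT_comp.
  + by apply: emeasurable_funD; exact: measurable_funeM.
  + move=> t At; rewrite -!EFinM -EFinD lee_fin; apply: le_dual => //.
    exact: w0.
- by move=> t At; rewrite mule_ge0 ?v0// lee_fin ltW.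
- exact: measurable_funeM.
- by move=> t At; rewrite mule_ge0 ?e0// lee_fin powR_ge0.
- exact: measurable_funeM.
Qed.

Lemma energy_integrable f : measurable_fun A f ->
  (energy p w A f < +oo)%E -> mu.-integrable A (EFin \o f).
Proof.
move=> mf efin; apply/integrableP; split; first exact/measurable_EFinP.
apply: le_lt_trans (L1_le_energy mf ltr01) _.
by rewrite powR1 !mul1e lte_add_pinfty.
Qed.

(** In [L1_le_energy], s is chosen first, to make the term in the dual weight
    smaller than e / 2; the bound d on the energy then handles the other term. *)
Lemma energy_L1_small e : 0 < e -> exists2 d, 0 < d &
  forall f, measurable_fun A f -> (energy p w A f < d%:E)%E ->
    (\int[mu]_(t in A) `|f t|%:E < e%:E)%E.
Proof.
move=> e0; set M := (\int[mu]_(t in A) (v t)%:E)%E.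
have M0 : (0 <= M)%E.
  by apply: integral_ge0 => t _; rewrite lee_fin dual_weight_ge0.
have Mf : M \is a fin_num by rewrite ge0_fin_numE.
have m0 : 0 <= fine M by exact: fine_ge0.
pose s := e / 2 / (fine M + 1).
have s0 : 0 < s by rewrite !divr_gt0// ltr_wpDl.
have sp : 0 < s `^ (1 - p) by exact: powR_gt0.
exists (e / 2 / s `^ (1 - p)); first by rewrite !divr_gt0.
move=> f mf fe; apply: le_lt_trans (L1_le_energy mf s0) _.
rewrite -/M -(fineK Mf) -EFinM.
have -> : e = e / 2 + s `^ (1 - p) * (e / 2 / s `^ (1 - p)).
  by field; rewrite gt_eqF.
rewrite [ltRHS]EFinD; apply: lee_ltD => //.
- rewrite lee_fin /s mulrAC ler_pdivrMr ?ltr_wpDl// ler_pM2l ?divr_gt0//.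
  by rewrite lerDl.
- by rewrite EFinM lte_pmul2l.
Qed.

End Control.

End DualWeight.

(** * Uniform convergence and local absolute continuity *)
Section FunctionSpaces.
Context {R : realType}.
Implicit Types (u : R -> R) (K : set R).

Lemma uniform_cvgP K (phi : nat -> R -> R) u :
  {uniform K, phi @ \oo --> u} <->
  forall e, 0 < e -> \forall n \near \oo, forall y, K y -> `|u y - phi n y| < e.
Proof.
split=> [H e e0|H P /uniform_nbhs[E [/= [e e0 eE] EP]]].
  suff /H : nbhs (u : {uniform` K -> R}) [set h | forall y, K y -> `|u y - h y| < e].
    by [].
  apply/uniform_nbhs; exists [set xy | ball xy.1 e xy.2]; split; first exact: (@entourage_ball _ R (PosNum e0)).
  by move=> h Hh y Ky; exact: (Hh y Ky).
by apply: filterS (H e e0) => n Hn; apply: EP => y Ky; apply: eE; exact: Hn.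
Qed.

Lemma lipschitz_loc_abs_continuous u :
  (forall x y, x <= y -> `|u y - u x| <= y - x) -> loc_abs_continuous u.
Proof.
move=> lip a b _ _ e e0; exists e => // n x y xy _; apply: le_lt_trans.
by apply: ler_sum => i _; apply: lip; case: (xy i).
Qed.

End FunctionSpaces.

(** * Approximation on the half-line *)
Section HalfLine.
Context {R : realType}.
Context (p : R) (w : R -> R).
Implicit Types (f g h u phi : R -> R) (a b t e : R).
Local Notation mu := (@lebesgue_measure R).
Local Notation v := (dual_weight p w).

Context (p1 : 1 < p) (w0 : forall t : R, 0 < t -> 0 < w t).
Context (w_cont : {within Rpos, continuous w}).

Let p0 : 0 < p. Proof. exact: lt_trans p1. Qed.
Let mRpos : measurable (Rpos : set R). Proof. exact: measurable_itv. Qed.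

Lemma RposE t : Rpos t = (0 < t) :> Prop.
Proof. by rewrite /Rpos/= in_itv/= andbT. Qed.

Let w_gt0 (A : set R) : A `<=` Rpos -> forall t, A t -> 0 < w t.
Proof. by move=> AR t /AR; rewrite RposE; exact: w0. Qed.

Let w_ge0 (A : set R) : A `<=` Rpos -> forall t, A t -> 0 <= w t.
Proof. by move=> AR t /(w_gt0 AR)/ltW. Qed.

Lemma weight_measurable (A : set R) : A `<=` Rpos -> measurable_fun A w.
Proof.
move=> AR; apply: (measurable_funS mRpos AR).
exact: subspace_continuous_measurable_fun.
Qed.

Let mw : measurable_fun Rpos w.
Proof. exact: (weight_measurable (@subset_refl _ Rpos)). Qed.

Let wR_ge0 : forall t, Rpos t -> 0 <= w t.
Proof. exact: (w_ge0 (@subset_refl _ Rpos)). Qed.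

Lemma weight_continuous t : 0 < t -> {for t, continuous w}.
Proof.
move=> t0; move: w_cont; rewrite continuous_open_subspace; last exact: interval_open.
by apply; apply/mem_set; rewrite RposE.
Qed.

Lemma dual_weight_continuous t : 0 < t -> {for t, continuous v}.
Proof.
move=> t0; apply: (@continuous_comp _ _ _ w (fun x => x `^ _)).
  exact: weight_continuous.
apply: differentiable_continuous; apply/derivable1_diffP.
by apply: derivable_powR; rewrite in_itv/= andbT w0.
Qed.

Lemma integrable_segment f a b : 0 < a ->
  (forall t, 0 < t -> {for t, continuous f}) ->
  mu.-integrable `[a, b] (EFin \o f).
Proof.
move=> a0 cf; apply: continuous_compact_integrable; first exact: segment_compact.
apply: continuous_in_subspaceT => t /set_mem; rewrite /= in_itv/= => /andP[ta _].
by apply: cf; exact: lt_le_trans ta.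
Qed.

Lemma integral_segment_fin (A : set R) f a b : 0 < a ->
  (forall t, 0 < t -> {for t, continuous f}) ->
  measurable A -> A `<=` `[a, b]%classic -> (forall t, A t -> 0 <= f t) ->
  (\int[mu]_(t in A) (f t)%:E < +oo)%E.
Proof.
move=> a0 cf mA Aab f0.
have /integrableP[_] : mu.-integrable A (EFin \o f).
  by apply: (@integrableS _ _ _ mu `[a, b]%classic) => //; exact: integrable_segment.
by under eq_integral => t /set_mem At do rewrite /= ger0_norm ?f0//.
Qed.

Lemma subset_Rpos a b : 0 <= a -> `]a, b[%classic `<=` (Rpos : set R).
Proof.
move=> a0 t; rewrite RposE /= in_itv/= => /andP[at_ _].
exact: le_lt_trans at_.
Qed.

Lemma energy_cst1_fin a b : 0 < a -> (energy p w `]a, b[ (cst 1%R) < +oo)%E.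
Proof.
move=> a0; rewrite /energy.
under eq_integral do rewrite normr1 powR1 mul1r.
apply: (@integral_segment_fin _ w a b) => //; first exact: weight_continuous.
  exact: subset_itv_oo_cc.
by apply: w_ge0; apply: subset_Rpos; exact: ltW.
Qed.

Lemma energy_subset (A : set R) f : measurable A -> A `<=` Rpos ->
  measurable_fun Rpos f -> (energy p w A f <= energy p w Rpos f)%E.
Proof.
move=> mA AR mf; apply: ge0_subset_integral => //.
- exact: (measurable_energy p mf (weight_measurable _)).
- by move=> t Rt; rewrite lee_fin mulr_ge0 ?powR_ge0// ltW// w0// -RposE.
Qed.

(** By dominated convergence the energy off ]1/n, n[ is small; on ]1/n, n[ the
    weight is bounded and the density result for bounded intervals applies. *)
Lemma energy_approx f : measurable_fun Rpos f -> (energy p w Rpos f < +oo)%E ->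
  forall e, 0 < e -> exists a b g, [/\ 0 < a, smooth g,
    forall t, ~ `]a, b[%classic t -> g t = 0 &
    (energy p w Rpos (fun t => f t - g t)%R < e%:E)%E].
Proof.
move=> mf ffin e e0.
have c0 : 0 < (2 : R) `^ p by exact: powR_gt0.
have d0 : 0 < e / (2 `^ p * 2) by rewrite divr_gt0// mulr_gt0.
pose D n : set R := `]n.+1%:R^-1, n.+1%:R[%classic.
have mD n : measurable (D n) by exact: measurable_itv.
have DR n : D n `<=` Rpos by apply: subset_Rpos.
have mI n : measurable_fun Rpos (\1_(~` D n) : R -> R).
  by apply: measurable_indic; exact: measurableC.
have mJ n : measurable_fun Rpos (\1_(D n) : R -> R) by exact: measurable_indic.
have [n Fn] : exists n,
    (energy p w Rpos (fun t => f t * \1_(~` D n) t)%R < (e / (2 `^ p * 2))%:E)%E.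
  apply: (energy_dominated (F := fun n t => f t * \1_(~` D n) t)
    (ltW p1) mRpos wR_ge0 mw _ mf _ _ ffin d0).
  - by move=> n; exact: measurable_funM.
  - move=> t; rewrite RposE => t0.
    suff : \forall n \near \oo, f t * \1_(~` D n) t = 0 by exact: cvg_near_cst.
    (* 1/(n+1) < min(t, 1/t) says that t lies in D n. *)
    have m0 : 0 < Num.min t t^-1 by rewrite lt_min t0 invr_gt0.
    near=> n; rewrite indicE memNset ?mulr0//; apply; rewrite /D/= in_itv/=.
    have : n.+1%:R^-1 < Num.min t t^-1.
      by near: n; exact: (near_infty_natSinv_lt (PosNum m0)).
    by rewrite lt_min ltf_pV2 ?posrE.
  - move=> n t _; rewrite normrM indicE; case: (_ \in _).
      by rewrite normr1 mulr1.
    by rewrite normr0 mulr0.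
have a0 : 0 < n.+1%:R^-1 :> R by rewrite invr_gt0.
have fD : (energy p w (D n) f < +oo)%E
  by exact: le_lt_trans (energy_subset (mD n) (@DR n) mf) ffin.
have [_ /(_ _ d0)[g [sg g0 fg]]] := approximable_energy (ltW p1) (w_ge0 (@DR n))
  (weight_measurable (@DR n)) (energy_cst1_fin _ a0)
  (measurable_funS mRpos (@DR n) mf) fD.
exists n.+1%:R^-1, n.+1%:R, g; split => //.
have mg := smooth_measurable (A := Rpos) sg.
rewrite (eq_energy p w (g := fun t => f t * \1_(~` D n) t + (f t * \1_(D n) t - g t))).
  apply: le_lt_trans (energyD (ltW p0) mRpos wR_ge0 mw _ _) _.
  - exact: measurable_funM.
  - by apply: measurable_funB => //; exact: measurable_funM.
  apply: (lte_mul_half c0 Fn).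
  rewrite (energy_support w p0 (@DR n)); last first.
    move=> t _ Dt; rewrite g0// subr0 indicE memNset// mulr0//.
  rewrite (eq_energy p w (g := fun t => f t - g t)) => [//|t Dt].
  by rewrite indicE mem_set// mulr1.
move=> t _; rewrite addrA -mulrDr !indicE in_setC.
by case: (t \in D n); rewrite /= ?add0r ?addr0 mulr1.
Unshelve. all: by end_near. Qed.

Lemma dual_integral_unbounded K : ~ Bpinfty p w -> exists N : R,
  (K%:E < \int[mu]_(t in `]1%R, N[) (v t)%:E)%E.
Proof.
move=> nB; apply: contrapT => H; apply: nB.
pose F n : set R := `]1, n.+1%:R[%classic.
have FR n : F n `<=` Rpos by apply: subset_Rpos.
have sR : `[1, +oo[%classic `<=` (Rpos : set R).
  by move=> t; rewrite RposE /= in_itv/= andbT; exact: lt_le_trans.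
have UF : \bigcup_n F n = `]1, +oo[%classic.
  apply/seteqP; split=> t /=; first by move=> [n _]; rewrite /F/= !in_itv/= => /andP[->].
  rewrite in_itv/= andbT => t1; exists (Num.truncn t) => //.
  by rewrite /F/= in_itv/= t1 truncnS_gt.
have mv A : A `<=` (Rpos : set R) -> measurable_fun A (EFin \o v).
  move=> AR; apply/measurable_EFinP.
  exact: measurable_dual_weight (weight_measurable AR).
have cF : (\int[mu]_(t in F n) (v t)%:E)%E @[n --> \oo] -->
    (\int[mu]_(t in `]1%R, +oo[) (v t)%:E)%E.
  rewrite -UF; apply: ge0_nondecreasing_set_cvg_integral.
  - move=> m n mn; apply/subsetPset => t; rewrite /F/= !in_itv/= => /andP[-> tm].
    by rewrite (lt_le_trans tm)// ler_nat ltnS.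
  - by move=> n; exact: measurable_itv.
  - by move=> n; exact: mv.
  - by move=> n t _; rewrite lee_fin dual_weight_ge0.
rewrite /Bpinfty -[X in (X < _)%E]/(\int[mu]_(t in `[1%R, +oo[) (v t)%:E)%E.
rewrite -integral_itv_obnd_cbnd; last first.
  apply: mv => t /= h; apply: sR => /=; rewrite !in_itv/= !andbT in h *.
  exact: ltW.
have <- := cvg_lim (@ereal_hausdorff _) cF.
apply: le_lt_trans (ltry K); apply: lime_le; first by apply/cvg_ex; eexists; exact: cF.
apply: nearW => n; rewrite leNgt; apply/negP => h; apply: H.
by exists n.+1%:R.
Qed.

(** Because v^p w = v. *)
Lemma energy_dual (A : set R) c : measurable A -> A `<=` Rpos -> 0 < c ->
  energy p w A (fun t => c * v t) =
  ((c `^ p)%:E * \int[mu]_(t in A) (v t)%:E)%E.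
Proof.
move=> mA AR c0; have mwA := weight_measurable AR.
rewrite energyZ//; last first.
- exact: measurable_dual_weight.
- exact: w_ge0.
rewrite gtr0_norm//; congr (_ * _)%E; apply: eq_integral => t /set_mem At.
have wt := w_gt0 AR At.
rewrite ger0_norm ?dual_weight_ge0// -(mulr_powRB1 (dual_weight_ge0 _ _ _) p0).
by rewrite -mulrA powR_dual// mulr1.
Qed.

(** With I the integral of v over ]1, N[, the function v / I has integral 1 and
    energy I^(1-p) there.  It is approximated on ]1, N[ by a smooth g, closely enough in
    energy for the integral of g to stay above 1/2; dividing g by its integral
    then multiplies the energy by at most 2^p. *)
Lemma unit_mass_small_energy e : ~ Bpinfty p w -> 0 < e ->
  exists a b h, [/\ 0 < a, smooth h,
    forall t, ~ `]a, b[%classic t -> h t = 0,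
    (\int[mu]_(t in setT) h t)%R = 1 & (energy p w Rpos h < e%:E)%E].
Proof.
move=> nB e0.
have c0 : 0 < (2 : R) `^ p by exact: powR_gt0.
(* One factor 2^p pays for the normalisation of g, the other for the quasi
   triangle inequality. *)
pose e1 := e / 2 `^ p / (2 `^ p * 2).
have e10 : 0 < e1 by rewrite !divr_gt0// mulr_gt0.
have q0 : 0 < p - 1 by rewrite subr_gt0.
(* The threshold on I above which I^(1-p) < e1. *)
have [N KN] := dual_integral_unbounded ((e1 `^ (p - 1)^-1)^-1) nB.
set K := (e1 `^ _)^-1 in KN.
have K0 : 0 < K by rewrite invr_gt0 powR_gt0.
pose A : set R := `]1, N[%classic.
have mA : measurable A by exact: measurable_itv.
have AR : A `<=` Rpos by exact: subset_Rpos.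
have mwA := weight_measurable AR.
have mvA : measurable_fun A v by exact: measurable_dual_weight.
have Ifin : (\int[mu]_(t in A) (v t)%:E < +oo)%E.
  apply: (@integral_segment_fin _ v 1 N) => //.
  - exact: dual_weight_continuous.
  - exact: subset_itv_oo_cc.
  - by move=> t _; exact: dual_weight_ge0.
pose I := fine (\int[mu]_(t in A) (v t)%:E)%E.
have IE : (\int[mu]_(t in A) (v t)%:E)%E = I%:E.
  rewrite fineK// ge0_fin_numE//.
  by apply: integral_ge0 => t _; rewrite lee_fin dual_weight_ge0.
have KI : K < I by rewrite -lte_fin -IE.
have I0 : 0 < I by exact: lt_trans KI.
have iv : mu.-integrable A (EFin \o v).
  apply/integrableP; split; first exact/measurable_EFinP.
  by under eq_integral do rewrite /= ger0_norm ?dual_weight_ge0//.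
pose h0 t := I^-1 * v t.
have mh0 : measurable_fun A h0 by exact: measurable_funM.
have ih0 : (\int[mu]_(t in A) h0 t)%R = 1.
  rewrite RintegralZl// /Rintegral -/I.
  by rewrite mulVf// gt_eqF.
have eh0 : (energy p w A h0 < e1%:E)%E.
  rewrite /h0 energy_dual ?invr_gt0// IE -EFinM lte_fin.
  rewrite -(mulr_powRB1 _ p0) ?invr_ge0 ?ltW// mulrAC mulVf ?gt_eqF// mul1r.
  have -> : e1 = (e1 `^ (p - 1)^-1) `^ (p - 1).
    by rewrite -powRrM mulVf ?gt_eqF// powRr1// ltW.
  apply: gt0_ltr_powR => //; rewrite ?nnegrE ?invr_ge0 ?powR_ge0 ?(ltW I0)//.
  by rewrite -[ltRHS]invrK ltf_pV2 ?posrE.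
have half0 : 0 < 1 / 2 :> R by rewrite divr_gt0.
have [d d0 Hd] := energy_L1_small p1 mA (w_gt0 AR) mwA Ifin half0.
have [] := approximable_energy (ltW p1) (w_ge0 AR) mwA
  (energy_cst1_fin N ltr01) mh0 (lt_trans eh0 (ltry _)).
move=> _ /(_ (Num.min e1 d)); rewrite lt_min e10 d0 => /(_ isT)[g [sg g0]].
rewrite -/A => hg.
have mg := smooth_measurable (A := A) sg.
have hge : (energy p w A (fun t => h0 t - g t)%R < e1%:E)%E.
  by apply: lt_le_trans hg _; rewrite lee_fin ge_min lexx.
have hgd : (energy p w A (fun t => h0 t - g t)%R < d%:E)%E.
  by apply: lt_le_trans hg _; rewrite lee_fin ge_min lexx orbT.
have mhg : measurable_fun A (fun t => h0 t - g t) by exact: measurable_funB.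
have ig := supported_integrable sg g0 mA.
have ih : mu.-integrable A (EFin \o h0) by exact: integrableZl_EFin.
pose c := (\int[mu]_(t in A) g t)%R.
have cE : (\int[mu]_(t in setT) g t)%R = c.
  by apply: (Rintegral_support _ g0); rewrite setTI setIid.
have c_half : 1 / 2 < c.
  have := Hd _ mhg hgd.
  have ihg : mu.-integrable A (EFin \o (fun t => h0 t - g t)).
    exact: (energy_integrable p1 mA (w_gt0 AR) mwA Ifin mhg (lt_trans hge (ltry _))).
  have mehg : measurable_fun A (EFin \o (fun t => h0 t - g t)).
    exact/measurable_EFinP.
  move=> /(le_lt_trans (le_abse_integral mu mA mehg)).
  rewrite -EFin_normr_Rintegral// lte_fin RintegralB// ih0 -/c.
  move=> /(le_lt_trans (ler_norm _)); lra.
have c_pos : 0 < c by apply: lt_trans c_half; rewrite divr_gt0.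
exists 1, N, (fun t => c^-1 * g t); split => //.
- exact: smoothZ.
- by move=> t /g0 ->; rewrite mulr0.
- rewrite RintegralZl//; last exact: (supported_integrable sg g0).
  by rewrite cE mulVf// gt_eqF.
rewrite (energy_support w p0 AR); last by move=> t _ /g0 ->; rewrite mulr0.
rewrite (energyZ p c^-1 mA (w_ge0 AR) mwA mg).
have eg : (energy p w A g < (e / 2 `^ p)%:E)%E.
  rewrite (eq_energy p w (g := fun t => h0 t + (-1) * (h0 t - g t))); last first.
    by move=> t _; rewrite mulN1r opprB addrC subrK.
  apply: le_lt_trans (energyD (ltW p0) mA (w_ge0 AR) mwA mh0 _) _.
    exact: measurable_funM.
  apply: (lte_mul_half c0 eh0).
  by rewrite (energyZ p (-1) mA (w_ge0 AR) mwA mhg) normrN1 powR1 mul1e.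
apply: (@le_lt_trans _ _ ((2 `^ p)%:E * energy p w A g)%E).
  rewrite lee_wpmul2r// ?energy_ge0 ?lee_fin//; first exact: w_ge0.
  apply: ge0_ler_powR; rewrite ?nnegrE ?(ltW p0)//.
  rewrite gtr0_norm ?invr_gt0// -[leRHS]invrK lef_pV2 ?posrE ?invr_gt0//.
  by rewrite -[_^-1]mul1r ltW.
have -> : e = 2 `^ p * (e / 2 `^ p) by rewrite mulrC divfK ?gt_eqF.
by rewrite EFinM lte_pmul2l.
Qed.

(** An approximant g of f is corrected into g - (int g) h, with h of unit mass
    and tiny energy; having integral zero, it is the derivative of a test
    function. *)
Lemma test_derivatives_dense f : ~ Bpinfty p w -> measurable_fun Rpos f ->
  (energy p w Rpos f < +oo)%E -> forall e, 0 < e ->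
  exists2 phi, test_function phi &
    (energy p w Rpos (fun t => f t - derive1 phi t)%R < e%:E)%E.
Proof.
move=> nB mf ffin e e0.
have c0 : 0 < (2 : R) `^ p by exact: powR_gt0.
pose d := e / (2 `^ p * 2).
have d0 : 0 < d by rewrite divr_gt0// mulr_gt0.
have [a [b [g [a0 sg g0 fg]]]] := energy_approx mf ffin d0.
pose c := (\int[mu]_(t in setT) g t)%R.
have k0 : 0 < `|c| `^ p + 1 by rewrite ltr_wpDl ?powR_ge0.
have [a' [b' [h [a'0 sh h0 h1 eh]]]] :=
  unit_mass_small_energy nB (divr_gt0 d0 k0).
pose psi t := g t - c * h t.
have spsi : smooth psi by apply: smoothB => //; exact: smoothZ.
have psi0 t : ~ `]Num.min a a', Num.max b b'[%classic t -> psi t = 0.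
  move=> nt; rewrite /psi g0 ?h0 ?mulr0 ?subrr//; apply: contra_not nt;
    by rewrite /= !in_itv/= gt_min lt_max => /andP[-> ->]; rewrite ?orbT.
have m0 : 0 < Num.min a a' by rewrite lt_min a0.
have ig := supported_integrable sg g0 measurableT.
have ih := supported_integrable sh h0 measurableT.
exists (primitive psi).
  apply: (primitive_test_function spsi psi0 m0).
  rewrite RintegralB//; last exact: integrableZl_EFin.
  by rewrite RintegralZl// h1 mulr1 subrr.
rewrite (primitive_derive1 spsi psi0).
have mg := smooth_measurable (A := Rpos) sg.
have mh := smooth_measurable (A := Rpos) sh.
rewrite (eq_energy p w (g := fun t => (f t - g t) + c * h t)); last first.
  by move=> t _; rewrite /psi opprB addrA [f t + _]addrC addrC addrA [_ + f t]addrC.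
apply: le_lt_trans (energyD (ltW p0) mRpos wR_ge0 mw _ _) _.
- exact: measurable_funB.
- exact: measurable_funM.
apply: (lte_mul_half c0 fg).
rewrite (energyZ p c mRpos wR_ge0 mw mh).
apply: (@le_lt_trans _ _ ((`|c| `^ p)%:E * (d / (`|c| `^ p + 1))%:E)%E).
  by rewrite lee_wpmul2l ?lee_fin ?powR_ge0// ltW.
by rewrite -EFinM lte_fin mulrA ltr_pdivrMr// mulrC ltr_pM2l// ltrDl.
Qed.

(** The estimate behind all three parts of the proof.  The bound d depends on A
    and e but not on t: A is ]0, t] for convergence at a point, ]0, T] for uniform convergence
    on compact sets and the whole half-line for the behaviour at infinity. *)
Lemma test_function_close (A : set R) e : measurable A -> A `<=` Rpos ->
  (\int[mu]_(t in A) (v t)%:E < +oo)%E -> 0 < e ->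
  exists2 d, 0 < d & forall phi f t, test_function phi ->
    measurable_fun Rpos f -> (energy p w Rpos f < +oo)%E ->
    (energy p w Rpos (fun s => derive1 phi s - f s)%R < d%:E)%E ->
    0 < t -> `]0, t]%classic `<=` A ->
    `|phi t - \int[mu]_(s in `]0, t]) f s| < e.
Proof.
move=> mA AR vA e0; have mwA := weight_measurable AR.
have [d d0 Hd] := energy_L1_small p1 mA (w_gt0 AR) mwA vA e0.
exists d => // phi f t tphi mf ef ephi t0 tA.
have mfA : measurable_fun A f.
  by apply: measurable_funS mf => //; exact: measurable_itv.
have efA : (energy p w A f < +oo)%E by exact: le_lt_trans (energy_subset mA AR mf) ef.
have fi := energy_integrable p1 mA (w_gt0 AR) mwA vA mfA efA.
have mt : measurable `]0, t]%classic by exact: measurable_itv.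
have fit : mu.-integrable `]0, t] (EFin \o f).
  exact: (@integrableS _ _ _ mu A).
rewrite -lte_fin; apply: le_lt_trans (test_function_dist tphi t0 fit) _.
have sphi' := smooth_derive (test_function_smooth tphi).
have md B : measurable_fun B f -> measurable_fun B (fun s => derive1 phi s - f s).
  by move=> mB; apply: measurable_funB => //; exact: smooth_measurable.
apply: le_lt_trans (Hd _ (md _ mfA) _).
  apply: ge0_subset_integral => //.
  by apply/measurable_EFinP; apply: measurableT_comp => //; exact: md.
by apply: le_lt_trans ephi; apply: energy_subset => //; exact: md.
Qed.

Lemma dual_weight_fin (A B : set R) : Bp0 p w -> measurable A -> measurable B ->
  B `<=` `]1, +oo[%classic -> A `<=` `]0, 1]%classic `|` B ->
  (\int[mu]_(t in B) (v t)%:E < +oo)%E -> (\int[mu]_(t in A) (v t)%:E < +oo)%E.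
Proof.
move=> B0 mA mB B1 AB vB.
have UR : `]0, 1]%classic `|` B `<=` Rpos.
  move=> t [|/B1] /=; rewrite RposE !in_itv/=; first by move=> /andP[].
  by rewrite andbT; exact: lt_trans.
have m01 : measurable (`]0, 1]%classic : set R) by exact: measurable_itv.
have mv : measurable_fun (`]0, 1]%classic `|` B) (EFin \o v).
  apply/measurable_EFinP.
  exact: measurable_dual_weight (weight_measurable UR).
apply: (@le_lt_trans _ _ (\int[mu]_(t in `]0%R, 1%R] `|` B) (v t)%:E)%E).
  apply: ge0_subset_integral => //; first exact: measurableU.
  by move=> t _; rewrite lee_fin dual_weight_ge0.
rewrite ge0_integral_setU//.
- by rewrite lte_add_pinfty.
- by move=> t _; rewrite lee_fin dual_weight_ge0.
- apply/eqP/seteqP; split => t //= [] /[swap] /B1 /=.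
  by rewrite !in_itv/= andbT => /lt_le_trans h /andP[_ /h]; rewrite ltxx.
Qed.

Lemma dual_weight_fin_itv T : Bp0 p w ->
  (\int[mu]_(t in `]0%R, T]) (v t)%:E < +oo)%E.
Proof.
move=> B0; have sub : `]1, T]%classic `<=` (`]1, +oo[%classic : set R).
  by apply: subset_itvl; rewrite bnd_simp.
apply: (dual_weight_fin (B := `]1, T]%classic)) => //.
- by move=> t /=; rewrite !in_itv/= => /andP[-> ->]; case: (leP t 1); [left|right].
- apply: (@integral_segment_fin _ v 1 T) => //.
  + exact: dual_weight_continuous.
  + by apply: subset_itv; rewrite bnd_simp.
  + by move=> t _; exact: dual_weight_ge0.
Qed.

(** * The two inclusions *)

(** Both u(t) and the integral of u' over ]0, t] are the limit of phi_n(t). *)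
Lemma dirichlet0_sub_R0 : Bp0 p w -> dirichlet0 p w `<=` R0_0 p w.
Proof.
move=> B0 u [du [phi [tphi cphi' cphi]]]; split => // t t0.
have [_ [mf /(wLp_norm_lty _ _ p0) ef]] := du.
have AR : `]0, t]%classic `<=` (Rpos : set R).
  by apply: subset_itvl; rewrite bnd_simp.
have mA : measurable (`]0, t]%classic : set R) by exact: measurable_itv.
have vA := dual_weight_fin_itv t B0.
have fi : mu.-integrable `]0, t] (EFin \o derive1 u).
  apply: (energy_integrable p1 mA (w_gt0 AR) (weight_measurable AR) vA).
    by apply: measurable_funS mf => //; exact: measurable_itv.
  exact: le_lt_trans (energy_subset mA AR mf) ef.
rewrite -[RHS]fineK; last exact: integrable_fin_num.
congr EFin; apply/eqP; rewrite -subr_eq0 -normr_eq0; apply: contraT => ne0.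
rewrite -[fine _]/(\int[mu]_(s in `]0, t]) derive1 u s)%R in ne0 *.
set e := `|_| in ne0.
have e0 : 0 < e / 2 by rewrite divr_gt0// lt0r ne0 normr_ge0.
have [d d0 Hd] := test_function_close mA AR vA e0.
have K1 : [set t] `<=` (Rpos : set R) by move=> _ ->; rewrite RposE.
have /uniform_cvgP/(_ _ e0) near1 := cphi _ (@compact_set1 _ t) K1.
have near2 := wLp_norm_cvg0 p0 d0 cphi'.
near \oo => n.
have h1 : `|phi n t - \int[mu]_(s in `]0, t]) derive1 u s| < e / 2.
  apply: Hd => //; near: n; exact: near2.
have h2 : `|u t - phi n t| < e / 2.
  suff : forall y, [set t] y -> `|u y - phi n y| < e / 2 by apply.
  by near: n; exact: near1.
suff : e < e by rewrite ltxx.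
rewrite {1}/e [ltRHS]splitr (le_lt_trans _ (ltrD h2 h1))//.
exact: ler_distD.
Unshelve. all: by end_near. Qed.

(** Convergence of the derivatives is provided by density, and the uniform
    convergence on compact sets follows from it by [test_function_close]. *)
Lemma R0_sub_dirichlet0 : Bp0 p w -> ~ Bpinfty p w -> R0_0 p w `<=` dirichlet0 p w.
Proof.
move=> B0 nB u [du uE]; split => //.
have [_ [mf /(wLp_norm_lty _ _ p0) ef]] := du.
(* Energies below (n+1)^(-p) are norms below 1/(n+1). *)
have phiP n : exists phi, test_function phi /\
    (energy p w Rpos (fun t => derive1 u t - derive1 phi t)%R <
     ((n.+1%:R^-1) `^ p)%:E)%E.
  have e0 : 0 < (n.+1%:R^-1 : R) `^ p by rewrite powR_gt0.
  have [phi ? ?] := test_derivatives_dense nB mf ef e0.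
  by exists phi.
have [phi phiE] := choice phiP.
have tphi n : test_function (phi n) by case: (phiE n).
have norm0 : wLp_norm p w (fun t => derive1 (phi n) t - derive1 u t)
    @[n --> \oo] --> 0%E.
  apply: (@squeeze_cvge _ _ _ _ (cst 0%E) _ (fun n => (n.+1%:R^-1)%:E)).
  - apply: nearW => n; rewrite poweR_ge0/=; apply: wLp_norm_le => //.
      by apply: energy_ge0 => t; rewrite RposE => /w0/ltW.
    by rewrite energy_distC; case: (phiE n).
  - exact: cvg_cst.
  - by apply: cvg_EFin; [exact: nearW|exact: cvg_harmonic].
exists phi; split => // K cK KR; apply/uniform_cvgP => e e0.
have [M [_ HM]] := compact_bounded cK.
pose T := `|M| + 1.
have KT y : K y -> y <= T.
  move=> Ky; apply: le_trans (ler_norm y) _; apply: HM => //.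
  by rewrite /T (le_lt_trans (ler_norm _))// ltrDl.
have AR : `]0, T]%classic `<=` (Rpos : set R).
  by apply: subset_itvl; rewrite bnd_simp.
have [d d0 Hd] := test_function_close (measurable_itv _) AR (dual_weight_fin_itv T B0) e0.
near=> n => y Ky; have y0 : 0 < y by rewrite -RposE; exact: KR.
rewrite distrC.
have -> : u y = (\int[mu]_(s in `]0, y]) derive1 u s)%R by rewrite /Rintegral -uE.
apply: Hd => //.
- near: n; exact: (wLp_norm_cvg0 p0 d0 norm0).
- by apply: subset_itvl; rewrite bnd_simp KT.
Unshelve. all: by end_near. Qed.

(** The witness is the primitive of a bump supported in [1, 2]: it is constant
    and positive, equal to m, beyond 2, whereas each test function vanishes at
    some such point, at distance m. *)
Lemma R0_not_sub_dirichlet0 : Bp0 p w -> Bpinfty p w ->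
  exists2 u, R0_0 p w u & ~ dirichlet0 p w u.
Proof.
move=> B0 Boo; pose g : R -> R := plateau 1 2 1; pose u := primitive g.
have sg : smooth g by exact: smooth_plateau.
have g0 t : ~ `]1, 2[%classic t -> g t = 0 by exact: plateau_out.
have u'E : derive1 u = g by exact: primitive_derive1 sg g0.
have du (x : R) : is_derive x 1 u (g x) by exact: primitive_is_derive sg g0 x.
have cu : continuous u by apply/smooth_continuous; exact: primitive_smooth sg g0.
have DR : `]1, 2[%classic `<=` (Rpos : set R) by exact: subset_Rpos.
have mwD := weight_measurable DR.
have mg A : measurable_fun A g by exact: smooth_measurable.
have eg : (energy p w Rpos g < +oo)%E.
  rewrite (energy_support w p0 DR); last by move=> t _; exact: g0.
  apply: le_lt_trans (energy_cst1_fin 2 ltr01).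
  apply: le_energy => //; first exact: ltW.
    by move=> t /(w_gt0 DR)/ltW.
  move=> t _; have /andP[? ?] := plateau01 1 2 1 t.
  by rewrite /g normr1 ger0_norm.
have diru : dirichlet p w u.
  split; last by split; rewrite u'E//; apply/(wLp_norm_lty _ _ p0).
  apply: lipschitz_loc_abs_continuous => x y xy.
  have [|z _ ->] := MVT_segment xy (fun z _ => du z).
    exact: continuous_subspaceT.
  have /andP[? ?] := plateau01 1 2 1 z.
  by rewrite normrM /g [`|y - x|]ger0_norm ?subr_ge0// ger0_norm// ler_piMl// subr_ge0.
exists u.
  split => // t t0; rewrite u'E /u (primitive_pos g0 t ler01) fineK//.
  apply: integrable_fin_num => //; exact: (supported_integrable sg g0).
move=> [_ [phi [tphi cphi' _]]].
pose m := (\int[mu]_(s in setT) g s)%R.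
have m0 : 0 < m.
  (* By the mean value theorem m is a value of g inside its support. *)
  have -> : m = u 2 - u 1.
    by rewrite /u (primitive_right g0 (lexx _)) (primitive_left g0 (lexx _)) subr0.
  have [z z12 ->] : exists2 z, z \in `]1, 2[%R & u 2 - u 1 = g z * (2 - 1).
    apply: MVT; first by rewrite ltr1n.
    exact: continuous_subspaceT.
  apply: mulr_gt0; last by rewrite subr_gt0 ltr1n.
  exact: (@plateau_gt0 _ 1 2 0 z z12).
have vR : (\int[mu]_(t in Rpos) (v t)%:E < +oo)%E.
  apply: (dual_weight_fin (B := `]1, +oo[%classic)) => //.
  - move=> t; rewrite RposE => t0 /=; rewrite !in_itv/= t0 andbT.
    by case: (leP t 1); [left|right].
  - rewrite integral_itv_obnd_cbnd//; apply/measurable_EFinP.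
    apply: measurable_dual_weight; apply: weight_measurable.
    by move=> t; rewrite RposE /= in_itv/= andbT; exact: lt_trans.
have [d d0 Hd] := test_function_close mRpos (@subset_refl _ Rpos) vR m0.
rewrite u'E in cphi'; have near1 := wLp_norm_cvg0 p0 d0 cphi'.
near \oo => n.
have [b ub] := test_function_bounded_support (tphi n).
pose t := Num.max 2 (b + 1).
have t2 : 2 <= t by rewrite le_max lexx.
have t0 : 0 < t by rewrite (lt_le_trans _ t2).
have : `|phi n t - \int[mu]_(s in `]0, t]) g s| < m.
  apply: Hd => //; last by apply: subset_itvl; rewrite bnd_simp.
  near: n; exact: near1.
rewrite -(primitive_pos g0 t ler01) (primitive_right g0 t2) ub.
  by rewrite sub0r normrN -/m gtr0_norm// ltxx.
by rewrite /t lt_max ltrDl ltr01 orbT.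
Unshelve. all: by end_near. Qed.

End HalfLine.

Theorem theorem4p1 (R : realType) (p : R) (w : R -> R)
  (hp : 1 < p)
  (w_pos : forall t : R, 0 < t -> 0 < w t)
  (w_cont : {within Rpos, continuous w})
  (w_Bp0 : Bp0 p w) :
  dirichlet0 p w = R0_0 p w <-> ~ Bpinfty p w.
Proof.
split=> [eq Boo|nB].
  have [u Ru nDu] := R0_not_sub_dirichlet0 hp w_pos w_cont w_Bp0 Boo.
  by apply: nDu; rewrite eq.
apply/seteqP; split.
- exact: dirichlet0_sub_R0.
- exact: R0_sub_dirichlet0.
Qed.
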